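(* For each integer $h \ge 1$, there exists a set of $2^{2h-1}+1$ strongly $\mathbb{C}$-unextendible mutually unbiased bases in $\mathbb{C}^{2^{2h}}$.
   Context: For $d>1$, the Hermitian inner product of vectors $A=(A(x))_{0\le x<d}$ and $B=(B(x))_{0\le x<d}$ in $\mathbb{C}^d$ is $\langle A,B\rangle=\sum_{x=0}^{d-1}A(x)\overline{B(x)}$, the norm of $A$ is $\|A\|=\sqrt{\langle A,A\rangle}$, and the angle between nonzero $A$ and $B$ is $\arccos\left(\frac{|\langle A,B\rangle|}{\|A\|\cdot\|B\|}\right)$. Two nonzero vectors $A,B\in\mathbb{C}^d$ are unbiased with respect to each other if the angle between them is $\arccos(1/\sqrt d)$, that is, $\frac{|\langle A,B\rangle|}{\|A\|\cdot\|B\|}=\frac{1}{\sqrt d}$. A set of $b$ mutually unbiased bases (MUBs) in $\mathbb{C}^d$ comprises $bd$ vectors in $\mathbb{C}^d$, partitioned into $b$ orthogonal bases for $\mathbb{C}^d$ (basis vectors need not have norm $1$), such that any two vectors from distinct bases are unbiased with respect to each other. A set of $b$ MUBs in $\mathbb{C}^d$ is strongly $\mathbb{C}$-unextendible if it cannot be enlarged by even one vector of a potential $(b+1)$-th basis; that is, there is no nonzero vector in $\mathbb{C}^d$ that is unbiased with respect to each of the $bd$ vectors of the MUBs. *)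

(* Defs.v *)
From HB Require Import structures.
From mathcomp Require Import all_boot all_order all_algebra.
From mathcomp Require Import complex.
From mathcomp Require Import reals.

Set Implicit Arguments.
Unset Strict Implicit.
Unset Printing Implicit Defensive.

Import Order.TTheory GRing.Theory Num.Theory.
Local Open Scope ring_scope.

(* The complex numbers are R[i], with R the real numbers; absolute values,
   norms and square roots are taken in R[i], so their values are complex
   numbers that happen to be real. *)

(* [dotmx] is conjugate-linear in its second argument. *)
Fact dotmx_sum (R : realType) (d : nat) (A B : 'rV[R[i]]_d) :
  dotmx A B = \sum_(x < d) A 0 x * Num.conj (B 0 x).
Proof. by rewrite dotmxE mxE; apply: eq_bigr => x _; rewrite !mxE. Qed.

Definition vnorm (R : realType) (d : nat) (A : 'rV[R[i]]_d) : R[i] :=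
  sqrtC (dotmx A A).

(* Equality of the cosines of the angle between A and B and of the angle
   arccos (1 / sqrt d). *)
Definition unbiased (R : realType) (d : nat) (A B : 'rV[R[i]]_d) : Prop :=
  [/\ A != 0, B != 0 &
      `|dotmx A B| / (vnorm A * vnorm B) = 1 / sqrtC (d%:R)].

Definition orthogonal_basis (R : realType) (d : nat)
    (e : d.-tuple 'rV[R[i]]_d) : Prop :=
  basis_of fullv e /\
  forall x y : 'I_d, x != y -> dotmx (tnth e x) (tnth e y) = 0.

(* For d > 1 a nonzero vector is not unbiased with respect to itself, so the
   vectors of such an indexed family are pairwise distinct, and the family
   amounts to a set of b * d vectors partitioned into b bases. *)
Definition MUBs (R : realType) (d b : nat)
    (E : 'I_b -> d.-tuple 'rV[R[i]]_d) : Prop :=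
  (forall i : 'I_b, orthogonal_basis (E i)) /\
  (forall (i j : 'I_b) (x y : 'I_d), i != j ->
     unbiased (tnth (E i) x) (tnth (E j) y)).

Definition strongly_unextendible (R : realType) (d b : nat)
    (E : 'I_b -> d.-tuple 'rV[R[i]]_d) : Prop :=
  ~ exists v : 'rV[R[i]]_d,
      v != 0 /\ forall (i : 'I_b) (x : 'I_d), unbiased v (tnth (E i) x).

(* Main.v *)
Require Import Defs.
From HB Require Import structures.
From mathcomp Require Import all_boot all_order all_algebra all_field.
From mathcomp Require Import complex.
From mathcomp Require Import reals ring.

(** The bases are the real mutually unbiased bases built from a Kerdock set.
    Let [V] be an elementary abelian 2-group of order [d = 2 ^ (2 * h)] with a
    nondegenerate pairing [<x, y>], and let [Q_i], for [i] in a set of [d / 2]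
    indices, be quadratic forms on [V] whose pairwise differences have a
    nondegenerate polar form. One basis is the standard one; the basis of index
    [i] consists of the vectors [(-1) ^ (Q_i x + <u, x>)], for [u] in [V]. Inside
    a basis, orthogonality is that of characters; across two of them, the inner
    product is the exponential sum of a nondegenerate quadratic form, which has
    square [d] ([sum_sign_bent]).

    Such a set of forms comes from the field [F] of order [2 ^ m], with
    [m = 2 * h - 1] odd, on [V = F * bool]. Writing [q y] for the second
    elementary symmetric function of the conjugates of [y], whose polar form is
    [Tr x Tr y + Tr (x y)], the forms are [Q_a (x, s) = q (a x) + s Tr (a x)]
    ([kquadD], [kpolar_inj]).

    Why no vector can be added. A vector [v] unbiased to the standard basis has
    entries of constant modulus. Suppose that it is unbiased to all the other
    bases, and let [P_i] be the map for which [<x, P_i z>] is the polar form of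
    [Q_i]. Fourier inversion in [u] turns the condition at the basis [i] into
    [\sum_x v_x \bar v_(x + z) (-1) ^ <x, P_i z> = 0] for every nonzero [z]
    ([flat_correlation]). For fixed [z] the [d / 2] vectors [P_i z] are distinct
    and lie in the orthogonal of [z], which has [d / 2] elements: hence they
    exhaust it, and summing over [i] isolates the two terms at [x] and [x + z].
    So [v_x \bar v_(x + z)] has real part zero ([flat_orthogonal]): the entries
    of [v], seen in the real plane, are pairwise orthogonal, and three of them
    cannot all be nonzero ([flat_vanishes]). *)

Set Implicit Arguments.
Unset Strict Implicit.
Unset Printing Implicit Defensive.

Import Order.TTheory GRing.Theory Num.Theory.
Local Open Scope ring_scope.

(** * Sums of signs over a finite abelian group *)

Section SignSums.
Variables (C : numDomainType) (V : finZmodType).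

(** Translation by [y] negates the sum. *)
Lemma sum_sign_linear (f : V -> bool) :
  {morph f : x y / x + y >-> x (+) y} -> (exists y, f y) ->
  \sum_x (-1) ^+ f x = 0 :> C.
Proof.
move=> fD [y fy]; set S := \sum_x _.
have SN : S = - S.
  rewrite {1}/S (reindex_inj (addIr y)) /= -sumrN.
  by apply: eq_bigr => x _; rewrite fD fy addbT signrN.
by apply/eqP; rewrite -[_ == 0](mulrn_eq0 _ 2) mulr2n {1}SN addNr.
Qed.

(** The diagonal shift [y = x + z] in the double sum makes the summand, for
    fixed [z], a sign that is linear in [x]; only [z = 0] survives. *)
Lemma sum_sign_bent (q : V -> bool) (B : V -> V -> bool) :
  (forall x z, q (x + z) = q x (+) q z (+) B x z) ->
  (forall z, {morph B^~ z : x y / x + y >-> x (+) y}) ->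
  (forall z, z != 0 -> exists x, B x z) ->
  (\sum_x (-1) ^+ q x) ^+ 2 = #|V|%:R :> C.
Proof.
move=> qD BD Bnd.
have q0 : q 0 = B 0 0 by have := qD 0 0; rewrite addr0 addbb.
have q00 : q 0 = false by rewrite q0 -[X in B X _]addr0 BD addbb.
rewrite expr2 mulr_sumr.
transitivity (\sum_z (-1) ^+ q z * \sum_x (-1) ^+ B x z : C).
  under eq_bigr => z _ do rewrite mulr_suml.
  under [RHS]eq_bigr => z _ do rewrite mulr_sumr.
  rewrite exchange_big [RHS]exchange_big /=; apply: eq_bigr => x _.
  rewrite (reindex_inj (addrI x)) /=; apply: eq_bigr => z _.
  rewrite -!signr_addb qD; congr (_ ^+ nat_of_bool _).
  by case: (q x); case: (q z); case: (B x z).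
rewrite (bigD1 0) //= q00 expr0 mul1r [X in _ + X]big1 ?addr0 => [|z z0]; last first.
  by rewrite (sum_sign_linear (BD z) (Bnd z z0)) mulr0.
rewrite (eq_bigr (fun=> 1)) ?sumr_const // => x _.
by have := qD x 0; rewrite addr0 q00 addbF => /esym/(canRL (addKb _))->; rewrite addbb.
Qed.

End SignSums.

(** * Kerdock sets of quadratic forms *)

(** The polar form of [quad i] is [dot x (polar i z)]. Injectivity of
    [polar^~ z] for all nonzero [z] says that the difference of any two forms of
    the set is nonsingular. The group [V] has exponent 2 because [dot] is
    nondegenerate with values in [bool]; see [addvv]. *)
Record kerdock_set (V : finZmodType) (I : finType) := KerdockSet {
  dot : V -> V -> bool;
  quad : I -> V -> bool;
  polar : I -> V -> V;
  dotC : commutative dot;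
  dotDl : forall z, {morph dot^~ z : x y / x + y >-> x (+) y};
  dot_nondeg : forall z, z != 0 -> exists x, dot x z;
  quadD : forall i x z,
    quad i (x + z) = quad i x (+) quad i z (+) dot x (polar i z);
  polar_inj : forall z, z != 0 -> injective (polar^~ z)
}.

Section KerdockSums.
Variables (C : numFieldType) (V : finZmodType) (I : finType).
Variable K : kerdock_set V I.
Local Notation "<< x , y >>" := (dot K x y) (format "<< x ,  y >>").
Local Notation Q := (quad K).
Local Notation P := (polar K).
Implicit Types (x y z u : V) (i : I).

Lemma dotDr x y z : << x, y + z >> = << x, y >> (+) << x, z >>.
Proof. by rewrite !(dotC K x) dotDl. Qed.

Lemma dot0l z : << 0, z >> = false.
Proof. by rewrite -[0]addr0 dotDl addbb. Qed.

Lemma dot0r z : << z, 0 >> = false.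
Proof. by rewrite dotC dot0l. Qed.

Lemma addvv z : z + z = 0.
Proof.
by apply/eqP; apply: contraT => /(dot_nondeg K)[x]; rewrite dotDr addbb.
Qed.

Lemma oppv z : - z = z.
Proof. by apply/eqP; rewrite eq_sym -addr_eq0 addvv. Qed.

Lemma addv_eq0 x y : (x + y == 0) = (x == y).
Proof. by rewrite -[RHS]subr_eq0 oppv. Qed.

Lemma quad0 i : Q i 0 = false.
Proof.
by have := quadD K i 0 0; rewrite addr0 dot0l addbF addbb.
Qed.

Lemma dot_polar_id i z : << z, P i z >> = false.
Proof. by have := quadD K i z z; rewrite addvv quad0 addbb. Qed.

Lemma sum_sign_dot x : \sum_u (-1) ^+ << u, x >> = (#|V| * (x == 0))%:R :> C.
Proof.
have [->|x0] := eqVneq x 0.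
  by under eq_bigr do rewrite dot0r expr0; rewrite sumr_const muln1.
by rewrite muln0; apply: sum_sign_linear (dot_nondeg K x0); apply: dotDl.
Qed.

Lemma sum_sign_quad i j u w : i != j ->
  (\sum_x (-1) ^+ (Q i x (+) << u, x >>) * (-1) ^+ (Q j x (+) << w, x >>)) ^+ 2
  = #|V|%:R :> C.
Proof.
move=> ij; under eq_bigr do rewrite -signr_addb.
apply: (@sum_sign_bent _ _ _ (fun x z => << x, P i z + P j z >>)).
- move=> x z; rewrite !quadD !dotDr.
  case: (Q i x); case: (Q i z); case: (Q j x); case: (Q j z);
  case: << u, x >>; case: << u, z >>; case: << w, x >>; case: << w, z >>;
  by case: << x, P i z >>; case: << x, P j z >>.
- by move=> z; apply: dotDl.
- move=> z z0; apply: (dot_nondeg K); rewrite addv_eq0.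
  by rewrite (inj_eq (polar_inj z0)).
Qed.

Section Orthogonal.
Hypothesis cardVI : (#|V| = 2 * #|I|)%N.

(** The vectors [P i z] are distinct and orthogonal to [z], and there are as many
    of them as there are vectors orthogonal to [z]. *)
Lemma sum_polar z (F : V -> C) : z != 0 ->
  \sum_i F (P i z) = \sum_(u | ~~ << u, z >>) F u.
Proof.
move=> z0; have Pinj := polar_inj (k := K) z0.
pose H := [set u | ~~ << u, z >>].
have cardH : #|H| = #|I|.
  (* Each element of H contributes 2 to the sum below, the others 0. *)
  apply/eqP; rewrite -(eqn_pmul2l (isT : 0 < 2)%N) -cardVI; apply/eqP.
  have : \sum_u (1 + (-1) ^+ << u, z >>) = #|V|%:R :> C.
    by rewrite big_split /= sum_sign_dot (negPf z0) muln0 addr0 sumr_const.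
  rewrite (bigID [pred u | << u, z >>]) /= big1 ?add0r; last first.
    by move=> u ->; rewrite expr1 subrr.
  under eq_bigr => u /negPf -> do rewrite expr0 -[1 + 1]/(2%:R).
  rewrite sumr_const -mulrnA => /eqP; rewrite eqr_nat => /eqP <-.
  by congr (_ * _)%N; apply: eq_card => u; rewrite !inE.
have PH : [set P i z | i : I] = H.
  apply/eqP; rewrite eqEcard card_imset // cardH leqnn andbT.
  by apply/subsetP => _ /imsetP[i _ ->]; rewrite inE dotC dot_polar_id.
rewrite (eq_bigl (mem [set P i z | i : I])); last first.
  by move=> u; rewrite PH !inE.
by rewrite big_imset //; move=> i j _ _; apply: Pinj.
Qed.

(** By [sum_polar] this is the character [u |-> (-1) ^ <x, u>] summed over the
    orthogonal of [z]; doubling it gives the same character times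
    [1 + (-1) ^ <u, z>], summed over the whole group. *)
Lemma sum_sign_polar x z : z != 0 ->
  \sum_i (-1) ^+ << x, P i z >>
    = (#|I| * (x == 0))%:R + (#|I| * (x == z))%:R :> C.
Proof.
move=> z0; rewrite (@sum_polar z (fun u => (-1) ^+ << x, u >>)) //.
apply: (@mulfI _ 2%:R); first by rewrite pnatr_eq0.
rewrite mulrDr -!natrM !mulnA -cardVI -(addv_eq0 x z) -!sum_sign_dot -big_split /=.
rewrite [RHS](bigID [pred u | << u, z >>]) /= [X in _ = X + _]big1 ?add0r.
  rewrite mulr_sumr; apply: eq_bigr => u /negPf uz.
  by rewrite dotDr uz addbF -mulr2n dotC mulr_natl.
by move=> u uz; rewrite dotDr uz addbT signrN subrr.
Qed.

End Orthogonal.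
End KerdockSums.

(** * Vectors with flat spectrum in every Kerdock basis *)

(** With bars for conjugates, the hypotheses say that [a \bar b], [b \bar c]
    and [a \bar c] are purely imaginary. The product of the first two is real
    and equals [|b|^2 a \bar c], so it is also imaginary, and hence zero. *)
Lemma orthogonal_triple_eq0 (C : numClosedFieldType) (a b c : C) :
  a * b^* + b * a^* = 0 -> b * c^* + c * b^* = 0 -> a * c^* + c * a^* = 0 ->
  [|| a == 0, b == 0 | c == 0].
Proof.
move=> /eqP; rewrite addr_eq0 => /eqP ab /eqP; rewrite addr_eq0 => /eqP bc.
move=> /eqP; rewrite addr_eq0 => /eqP ac.
have E1 : (a * b^*) * (b * c^*) = (b * b^*) * (a * c^*) by ring.
have E2 : (b * a^*) * (c * b^*) = (b * b^*) * (c * a^*) by ring.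
have : (b * b^*) * (a * c^*) = - ((b * b^*) * (a * c^*)).
  by rewrite -{1}E1 ab bc mulrNN E2 ac mulrN opprK.
move/eqP; rewrite -addr_eq0 -mulr2n mulrn_eq0 /= !mulf_eq0 !conjC_eq0.
by case: (a == 0); case: (b == 0); case: (c == 0).
Qed.

Section FlatSpectrum.
Variables (C : numClosedFieldType) (V : finZmodType) (I : finType).
Variable K : kerdock_set V I.
Local Notation "<< x , y >>" := (dot K x y) (format "<< x ,  y >>").
Local Notation Q := (quad K).
Local Notation P := (polar K).
Variables (v : V -> C) (N : C).
Hypothesis flat : forall i u,
  `|\sum_x v x * (-1) ^+ (Q i x (+) << u, x >>)| ^+ 2 = N.

(** Expand the squared modulus and apply Fourier inversion in [u]: the character
    [(-1) ^ <u, z>] keeps the pairs of entries of [v] at distance [z], and kills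
    the constant [N] since [z] is nonzero. *)
Lemma flat_correlation i z : z != 0 ->
  \sum_x v x * (v (x + z))^* * (-1) ^+ << x, P i z >> = 0.
Proof.
move=> z0.
have : \sum_u (-1) ^+ << u, z >> *
         `|\sum_x v x * (-1) ^+ (Q i x (+) << u, x >>)| ^+ 2 = 0.
  under eq_bigr do rewrite flat.
  by rewrite -mulr_suml sum_sign_dot (negPf z0) muln0 mul0r.
suff -> : \sum_u (-1) ^+ << u, z >> *
         `|\sum_x v x * (-1) ^+ (Q i x (+) << u, x >>)| ^+ 2 =
    #|V|%:R * (-1) ^+ Q i z *
      \sum_x v x * (v (x + z))^* * (-1) ^+ << x, P i z >>.
  move/eqP; rewrite !mulf_eq0 signr_eq0 pnatr_eq0 orbF.
  have /negPf-> : #|V| != 0%N by rewrite -lt0n; apply/card_gt0P; exists z.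
  by move/eqP.
transitivity (\sum_x \sum_w v x * (v (x + w))^* *
    (-1) ^+ (Q i x (+) Q i (x + w)) * \sum_u (-1) ^+ << u, w + z >>).
  under [RHS]eq_bigr => x _.
    under eq_bigr => w _ do rewrite mulr_sumr.
    over.
  under [RHS]eq_bigr do rewrite exchange_big.
  rewrite [RHS]exchange_big /=; apply: eq_bigr => u _.
  rewrite normCK rmorph_sum mulr_suml mulr_sumr; apply: eq_bigr => x _.
  rewrite mulr_sumr mulr_sumr (reindex_inj (addrI x)) /=.
  apply: eq_bigr => w _; rewrite rmorphM rmorph_sign !dotDr !signr_addb.
  have := signrMK (R := C) << u, x >> 1; rewrite mulr1 => sK.
  transitivity (v x * (v (x + w))^* * ((-1) ^+ Q i x * (-1) ^+ Q i (x + w)) *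
     ((-1) ^+ << u, w >> * (-1) ^+ << u, z >>) *
     ((-1) ^+ << u, x >> * (-1) ^+ << u, x >>)); first by ring.
  by rewrite sK mulr1.
rewrite mulr_sumr; apply: eq_bigr => x _.
rewrite (bigD1 z) //= [X in _ + X]big1 ?addr0 => [|w wz]; last first.
  by rewrite sum_sign_dot (addv_eq0 K) (negPf wz) muln0 mulr0.
rewrite sum_sign_dot (addvv K) eqxx muln1 quadD !signr_addb.
have := signrMK (R := C) (Q i x) 1; rewrite mulr1 => sK.
transitivity ((v x * (v (x + z))^* * ((-1) ^+ Q i z * (-1) ^+ << x, P i z >>) *
   #|V|%:R) * ((-1) ^+ Q i x * (-1) ^+ Q i x)); first by ring.
by rewrite sK mulr1; ring.
Qed.

(** Average [flat_correlation] over [i] with weights [(-1) ^ <x, P i z>]; by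
    [sum_sign_polar] only the terms at [x] and [x + z] survive. *)
Lemma flat_orthogonal x z : (#|V| = 2 * #|I|)%N -> z != 0 ->
  v x * (v (x + z))^* + v (x + z) * (v x)^* = 0.
Proof.
move=> cardVI z0.
have : \sum_i (-1) ^+ << x, P i z >> *
         \sum_y v y * (v (y + z))^* * (-1) ^+ << y, P i z >> = 0.
  by rewrite big1 // => i _; rewrite flat_correlation // mulr0.
suff -> : \sum_i (-1) ^+ << x, P i z >> *
         \sum_y v y * (v (y + z))^* * (-1) ^+ << y, P i z >> =
    #|I|%:R * (v x * (v (x + z))^* + v (x + z) * (v x)^*).
  move/eqP; rewrite mulf_eq0 pnatr_eq0 => /predU1P[I0|/eqP//].
  by have := fintype0 z; rewrite cardVI I0 => /(_ erefl).
transitivity (\sum_y v y * (v (y + z))^* * \sum_i (-1) ^+ << x + y, P i z >>).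
  under [RHS]eq_bigr do rewrite mulr_sumr.
  rewrite [RHS]exchange_big; apply: eq_bigr => i _.
  rewrite mulr_sumr; apply: eq_bigr => y _.
  by rewrite dotDl signr_addb; ring.
under eq_bigr => y _.
  rewrite (sum_sign_polar _ K cardVI) // (addv_eq0 K).
  rewrite (_ : (x + y == z) = (y == x + z)); last first.
    by rewrite -subr_eq0 (oppv K) addrAC addrC (addv_eq0 K).
  over.
have sum_delta w (F : V -> C) : \sum_y F y * (#|I| * (y == w))%:R = #|I|%:R * F w.
  rewrite (bigD1 w) //= eqxx muln1 mulrC big1 ?addr0 // => y /negPf->.
  by rewrite muln0 mulr0.
under eq_bigr do rewrite mulrDr (eq_sym x).
rewrite big_split /= !sum_delta -addrA (addvv K) addr0 mulrDr.
by congr (_ + _ * _).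
Qed.

(** As vectors of the real plane the values of [v] are pairwise orthogonal,
    and the plane has no room for three nonzero ones. *)
Lemma flat_vanishes : (#|V| = 2 * #|I|)%N -> (2 < #|V|)%N ->
  exists x, v x = 0.
Proof.
move=> cardVI Vgt2.
have /card_gt0P[y /setD1P[y0 _]] : (0 < #|[set: V] :\ (0%R : V)|)%N.
  by rewrite cardsDS ?sub1set // cardsT cards1; case: #|V| Vgt2 => [|[]].
have /card_gt0P[z /setD1P[zy /setD1P[z0 _]]] : (0 < #|[set: V] :\ (0%R : V) :\ y|)%N.
  rewrite 2?cardsDS ?sub1set ?inE ?y0 // cardsT !cards1.
  by case: #|V| Vgt2 => [|[|[]]].
have := orthogonal_triple_eq0 (flat_orthogonal 0 cardVI y0).
rewrite !add0r => /(_ (v z)).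
have := flat_orthogonal y (z := z - y) cardVI; rewrite subr_eq0 subrKC.
move=> /(_ zy) yz /(_ yz); have := flat_orthogonal 0 cardVI z0; rewrite add0r.
by move=> vz /(_ vz) /or3P[] /eqP; [exists 0 | exists y | exists z].
Qed.
End FlatSpectrum.

(** * The Kerdock set of a binary field of odd degree *)

HB.instance Definition _ (U W : finZmodType) := GRing.Zmodule.on (U * W)%type.

(** ** The second elementary symmetric function *)

Section SecondSymmetric.
Variable R : comNzRingType.
Implicit Types c : nat -> R.

Definition esym2 n c := \sum_(0 <= i < n) c i * \sum_(0 <= j < i) c j.

Lemma esym2D n c1 c2 :
  esym2 n (fun i => c1 i + c2 i) =
    esym2 n c1 + esym2 n c2 +
    ((\sum_(0 <= i < n) c1 i) * (\sum_(0 <= i < n) c2 i) -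
     \sum_(0 <= i < n) c1 i * c2 i).
Proof.
rewrite /esym2; elim: n => [|n IHn]; first by rewrite !big_geq //; ring.
by rewrite !big_nat_recr //= IHn big_split /=; ring.
Qed.

(** Both sides differ from [esym2 n.+1 c] by the products with one end term,
    [c 0] or [c n]. For [c] the list of conjugates of a field element this is
    the invariance of [esym2] under the Frobenius automorphism. *)
Lemma esym2_shift n c : c n = c 0%N -> esym2 n (c \o succn) = esym2 n c.
Proof.
move=> cn; have sumE : \sum_(0 <= i < n) c i.+1 = \sum_(0 <= i < n) c i.
  by apply: (addrI (c 0%N)); rewrite -big_nat_recl // big_nat_recr //= cn addrC.
apply: (addrI (c 0%N * \sum_(0 <= i < n) c i)); transitivity (esym2 n.+1 c).
  rewrite /esym2 big_nat_recl // (big_geq (leqnn 0)) mulr0 add0r.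
  under [RHS]eq_bigr => i _ do rewrite big_nat_recl // mulrDr.
  by rewrite big_split /= -mulr_suml sumE mulrC.
by rewrite /esym2 big_nat_recr //= cn addrC.
Qed.

End SecondSymmetric.

(** ** Trace, quadratic forms and polar maps *)

Section BinaryField.
Variables (F : finFieldType) (m : nat).
Hypotheses (pchar2 : 2%N \in [pchar F]) (cardF : #|F| = (2 ^ m)%N).
Hypothesis m_odd : odd m.
Implicit Types x y a : F.

Definition conjugate x i : F := x ^+ (2 ^ i).
Definition ftrace x := \sum_(0 <= i < m) conjugate x i.
Definition fquad x := esym2 m (conjugate x).

Lemma sqrD x y : (x + y) ^+ 2 = x ^+ 2 + y ^+ 2.
Proof. by rewrite sqrrD mulr2n addrr_pchar2 // addr0. Qed.

Lemma sqr_sum (r : seq nat) (G : nat -> F) :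
  (\sum_(i <- r) G i) ^+ 2 = \sum_(i <- r) G i ^+ 2.
Proof.
apply: (big_morph (fun x => x ^+ 2)) => [x y|]; first exact: sqrD.
by rewrite expr0n.
Qed.

Lemma conjugateS x i : conjugate x i.+1 = conjugate x i ^+ 2.
Proof. by rewrite /conjugate -exprM expnSr. Qed.

Lemma conjugateD x y i : conjugate (x + y) i = conjugate x i + conjugate y i.
Proof. by elim: i => [|i IHi]; rewrite ?conjugateS ?IHi ?sqrD. Qed.

Lemma conjugateM x y i : conjugate (x * y) i = conjugate x i * conjugate y i.
Proof. exact: exprMn. Qed.

Lemma conjugate_last x : conjugate x m = conjugate x 0.
Proof. by rewrite /conjugate -cardF expf_card. Qed.

Lemma ftrace_sqr x : ftrace x ^+ 2 = ftrace x.
Proof.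
rewrite sqr_sum; under eq_bigr do rewrite -conjugateS.
apply: (addrI (conjugate x 0)).
by rewrite -big_nat_recl // big_nat_recr //= conjugate_last addrC.
Qed.

Lemma fquad_sqr x : fquad x ^+ 2 = fquad x.
Proof.
rewrite -[RHS](esym2_shift (conjugate_last x)) /fquad /esym2 sqr_sum.
apply: eq_bigr => i _; rewrite exprMn sqr_sum /= -conjugateS.
by under eq_bigr do rewrite -conjugateS.
Qed.

Lemma ftraceD x y : ftrace (x + y) = ftrace x + ftrace y.
Proof. by rewrite -big_split; apply: eq_bigr => i _; apply: conjugateD. Qed.

Lemma fquadD x y :
  fquad (x + y) = fquad x + fquad y + (ftrace x * ftrace y - ftrace (x * y)).
Proof.
have -> : ftrace (x * y) = \sum_(0 <= i < m) conjugate x i * conjugate y i.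
  by apply: eq_bigr => i _; apply: conjugateM.
rewrite -esym2D; apply: eq_bigr => i _; rewrite conjugateD; congr (_ * _).
by apply: eq_bigr => j _; rewrite conjugateD.
Qed.

(** Inverse of the embedding of [bool], with [(+)] and [&&], as the prime field;
    meaningful on idempotents, see [bitK]. *)
Definition bit x : bool := x != 0.

Lemma bitK x : x ^+ 2 = x -> (bit x)%:R = x.
Proof.
move=> /eqP; rewrite -subr_eq0 -[X in _ - X]mulr1 -mulrBr mulf_eq0 /bit.
by case: eqP => [-> | _] //=; rewrite subr_eq0 => /eqP->.
Qed.

Lemma bit_nat (b : bool) : bit b%:R = b.
Proof. by case: b; rewrite /bit ?oner_eq0 ?eqxx. Qed.

Lemma natr_addb (b c : bool) : (b (+) c)%:R = b%:R + c%:R :> F.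
Proof. by case: b c => [] [] //=; rewrite ?addr0 ?add0r ?addrr_pchar2. Qed.

Definition trace x := bit (ftrace x).
Definition tquad x := bit (fquad x).

Lemma traceD x y : trace (x + y) = trace x (+) trace y.
Proof.
by rewrite -[RHS]bit_nat natr_addb !bitK ?ftrace_sqr // /trace ftraceD.
Qed.

Lemma tquadD x y :
  tquad (x + y) = tquad x (+) tquad y (+) (trace x && trace y (+) trace (x * y)).
Proof.
rewrite -[RHS]bit_nat !natr_addb -mulnb natrM !bitK ?ftrace_sqr ?fquad_sqr //.
by rewrite /tquad fquadD oppr_pchar2.
Qed.

Lemma trace0 : trace 0 = false.
Proof. by rewrite -[0]addr0 traceD addbb. Qed.

Lemma trace1 : trace 1.
Proof.
rewrite /trace /ftrace; under eq_bigr do rewrite /conjugate expr1n.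
rewrite sumr_const_nat subn0 -(odd_double_half m) m_odd mulrnDr -mul2n mulrnA.
by rewrite mulr2n addrr_pchar2 // mul0rn addr0 (bit_nat true).
Qed.

Lemma traceMb x (b : bool) : trace (x * b%:R) = trace x && b.
Proof. by case: b; rewrite ?mulr1 ?mulr0 ?trace0 ?andbT ?andbF. Qed.

Lemma trace_bit (b : bool) : trace b%:R = b.
Proof. by case: b; rewrite ?trace1 ?trace0. Qed.

Definition fdot (u w : F * bool) := trace (u.1 * w.1) (+) (u.2 && w.2).
Definition kquad a (u : F * bool) := tquad (a * u.1) (+) (u.2 && trace (a * u.1)).
Definition kpolar a (u : F * bool) : F * bool :=
  (a * (a * u.1 + (trace (a * u.1))%:R + u.2%:R), trace (a * u.1)).

Lemma fdotC : commutative fdot.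
Proof. by move=> u w; rewrite /fdot mulrC andbC. Qed.

Lemma fdotDl w : {morph fdot^~ w : x y / x + y >-> x (+) y}.
Proof.
move=> [x s] [y t]; rewrite /fdot /= mulrDl traceD.
by rewrite -[s + t]/(s (+) t) andb_addl addbACA.
Qed.

(** Since [m] is odd, [1] has trace 1, so [x^-1] detects a nonzero [x]. *)
Lemma fdot_nondeg w : w != 0 -> exists u, fdot u w.
Proof.
case: w => x [] w0; first by exists (0, true); rewrite /fdot mul0r trace0.
have x0 : x != 0 by apply: contraNneq w0 => ->.
by exists (x^-1, false); rewrite /fdot /= mulVf ?trace1.
Qed.

Lemma kquadD a u w :
  kquad a (u + w) = kquad a u (+) kquad a w (+) fdot u (kpolar a w).
Proof.
case: u w => [x s] [y t]; rewrite /kquad /fdot /= -[s + t]/(s (+) t).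
rewrite mulrDr tquadD traceD.
have -> : x * (a * (a * y + (trace (a * y))%:R + t%:R)) =
   (a * x) * (a * y) + a * x * (trace (a * y))%:R + a * x * t%:R by ring.
rewrite !traceD !traceMb.
by case: (tquad (a * x)); case: (tquad (a * y)); case: (trace (a * x));
   case: (trace (a * y)); case: (trace (_ * _)); case: s; case: t.
Qed.

(** Let [e = a - c] and suppose that [kpolar a] and [kpolar c] agree at [(y, t)].
    The second coordinates give [Tr (e y) = 0]; dividing the equality of the
    first ones by [e] gives [e y = Tr (c y) + t], an element of the prime field.
    As [m] is odd, an element of the prime field with trace 0 is 0; hence
    [y = 0] if [e] is nonzero, and then [t = 0]. *)
Lemma kpolar_inj w : w != 0 -> injective (kpolar^~ w).
Proof.
case: w => [y t] w0 a c [Eac Tac]; apply/eqP; apply: contraNT w0.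
rewrite -subr_eq0; set e := a - c => e0.
have Tey : trace (e * y) = false.
  by rewrite /e (oppr_pchar2 pchar2) mulrDl traceD Tac addbb.
have ey : e * y = (trace (c * y) (+) t)%:R.
  apply/eqP; rewrite -subr_eq0 -(mulrI_eq0 _ (mulfI e0)) (oppr_pchar2 pchar2).
  rewrite natr_addb.
  move/eqP: Eac; rewrite Tac -subr_eq0 => /eqP <-.
  have -> : a = e + c by rewrite /e subrK.
  (* The two sides differ by twice e c y, which vanishes in characteristic 2. *)
  apply/eqP; rewrite -[LHS]addr0 -[X in _ + X](addrr_pchar2 pchar2 (e * c * y)).
  by ring.
move: (Tey); rewrite ey trace_bit => Tt.
move: ey; rewrite Tt => /eqP; rewrite mulf_eq0 (negPf e0) => /eqP y0.
by move: Tt; rewrite y0 mulr0 trace0 addFb => ->.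
Qed.

Definition field_kerdock_set : kerdock_set (F * bool)%type F :=
  KerdockSet fdotC fdotDl fdot_nondeg kquadD kpolar_inj.

End BinaryField.

(** * From functions on a group to bases of row vectors *)

(** Squaring both sides, which are nonnegative, removes the square roots. *)
Lemma cosine_sqr (C : numClosedFieldType) (n a b c : C) :
  0 <= n -> 0 < a -> 0 < b -> 0 < c ->
  n / (sqrtC a * sqrtC b) = 1 / sqrtC c <-> n ^+ 2 * c = a * b.
Proof.
move=> n_ge0 a_gt0 b_gt0 c_gt0.
have ab0 : a * b != 0 by rewrite mulf_neq0 ?gt_eqF.
have c0 : c != 0 by rewrite gt_eqF.
have -> : (n / (sqrtC a * sqrtC b) = 1 / sqrtC c) <->
    (n / (sqrtC a * sqrtC b)) ^+ 2 = (1 / sqrtC c) ^+ 2.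
  split=> [-> //|]; apply: pexpIrn; rewrite // nnegrE divr_ge0 //.
    by rewrite mulr_ge0 // sqrtC_ge0 ltW.
  by rewrite sqrtC_ge0 ltW.
rewrite !expr_div_n exprMn !sqrtCK expr1n.
split=> [/eqP | E]; first by rewrite eqr_div // mul1r => /eqP.
by apply/eqP; rewrite eqr_div // mul1r E.
Qed.

Section Rows.
Variables (R : realType) (V : finType) (d : nat).
Hypothesis cardV : #|V| = d.
Local Notation C := R[i].
Implicit Types f g : V -> C.

(** The space of functions on [V] stands for that of row vectors, so that the
    entries can be indexed by a group; [dotmx_row_fun] makes the transport
    isometric. *)
Definition inner f g : C := \sum_x f x * (g x)^*.

Definition point (k : 'I_d) : V := enum_val (cast_ord (esym cardV) k).
Definition coord (x : V) : 'I_d := cast_ord cardV (enum_rank x).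

Lemma pointK : cancel point coord.
Proof. by move=> k; rewrite /point /coord enum_valK cast_ordKV. Qed.

Lemma coordK : cancel coord point.
Proof. by move=> x; rewrite /point /coord cast_ordK enum_rankK. Qed.

Definition row_fun f : 'rV[C]_d := \row_k f (point k).

Lemma dotmx_row_fun f g : dotmx (row_fun f) (row_fun g) = inner f g.
Proof.
rewrite dotmx_sum /inner (reindex point) /=; last first.
  by exists coord => k _; [apply: pointK | apply: coordK].
by apply: eq_bigr => k _; rewrite !mxE.
Qed.

Lemma row_fun_surj (A : 'rV[C]_d) : exists f, A = row_fun f.
Proof.
by exists (A 0 \o coord); apply/rowP => k; rewrite mxE /= pointK.
Qed.

Lemma dotmx_eq0 (A : 'rV[C]_d) : (dotmx A A == 0) = (A == 0).
Proof. exact: (dnorm_eq0 (@dotmx _ d)). Qed.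

Lemma dotmx_gt0 (A : 'rV[C]_d) : A != 0 -> 0 < dotmx A A.
Proof. exact: dotmx_is_dotmx. Qed.

Lemma unbiased_sqr (A B : 'rV[C]_d) : (0 < d)%N -> A != 0 -> B != 0 ->
  unbiased A B <-> `|dotmx A B| ^+ 2 * d%:R = dotmx A A * dotmx B B.
Proof.
move=> d_gt0 A0 B0.
rewrite -cosine_sqr ?normr_ge0 ?ltr0n ?dotmx_gt0 //.
by split=> [[]|].
Qed.

Lemma orthogonal_basis_neq0 (X : d.-tuple 'rV[C]_d) :
  (forall k, tnth X k != 0) ->
  (forall k l, k != l -> dotmx (tnth X k) (tnth X l) = 0) ->
  orthogonal_basis X.
Proof.
move=> X_neq0 X_orth; split=> //.
rewrite basisEfree subvf size_tuple dimvf dim_matrix mul1r leqnn !andbT.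
apply/freeP => a; under eq_bigr do rewrite -tnth_nth.
move=> sum0 k; have := congr1 (fun A => dotmx A (tnth X k)) sum0.
rewrite linear_sumlz /= linear0l (bigD1 k) //= big1 ?addr0 => [|l lk].
  rewrite linearZl_LR /= => /eqP.
  by rewrite mulf_eq0 dotmx_eq0 (negPf (X_neq0 k)) orbF => /eqP.
by rewrite linearZl_LR /= X_orth ?mulr0.
Qed.

Lemma unextendible_MUBs_of_functions (J : finType) (b : nat)
    (e : J -> V -> V -> C) :
  #|J| = b -> (0 < d)%N ->
  (forall j u, inner (e j u) (e j u) != 0) ->
  (forall j u w, u != w -> inner (e j u) (e j w) = 0) ->
  (forall j k u w, j != k ->
     `|inner (e j u) (e k w)| ^+ 2 * d%:R
       = inner (e j u) (e j u) * inner (e k w) (e k w)) ->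
  (forall f, (forall j u, `|inner f (e j u)| ^+ 2 * d%:R
                = inner f f * inner (e j u) (e j u)) -> inner f f = 0) ->
  exists E : 'I_b -> d.-tuple 'rV[C]_d, MUBs E /\ strongly_unextendible E.
Proof.
move=> cardJ d_gt0 e_neq0 e_orth e_unb e_unext.
pose idx (i : 'I_b) : J := enum_val (cast_ord (esym cardJ) i).
have idxK : cancel (fun j => cast_ord cardJ (enum_rank j)) idx.
  by move=> j; rewrite /idx cast_ordK enum_rankK.
have idx_inj : injective idx by move=> i j /enum_val_inj/cast_ord_inj.
have row_neq0 j u : row_fun (e j u) != 0.
  by rewrite -dotmx_eq0 dotmx_row_fun.
exists (fun i => [tuple row_fun (e (idx i) (point k)) | k < d]); split.
  split=> [i | i j k l ij].
    apply: orthogonal_basis_neq0 => [k | k l kl]; rewrite !tnth_mktuple //.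
    by rewrite dotmx_row_fun e_orth // (can_eq pointK).
  rewrite !tnth_mktuple; apply/unbiased_sqr => //.
  by rewrite !dotmx_row_fun e_unb // (inj_eq idx_inj).
case=> v [v0 v_unb]; have [f def_v] := row_fun_surj v.
case/negP: v0; rewrite -dotmx_eq0 def_v dotmx_row_fun; apply/eqP/e_unext => j u.
have [v0 row0 _] := v_unb (cast_ord cardJ (enum_rank j)) (coord u).
have /(unbiased_sqr d_gt0 v0 row0) := v_unb (cast_ord cardJ (enum_rank j)) (coord u).
by rewrite tnth_mktuple idxK coordK def_v !dotmx_row_fun.
Qed.

End Rows.

(** * Kerdock bases *)

Section KerdockBases.
Variables (R : realType) (V : finZmodType) (I : finType).
Variable K : kerdock_set V I.
Local Notation C := R[i].
Local Notation "<< x , y >>" := (dot K x y) (format "<< x ,  y >>").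
Local Notation Q := (quad K).

Definition kerdock_vector (o : option I) (u x : V) : C :=
  if o is Some i then (-1) ^+ (Q i x (+) << u, x >>) else (x == u)%:R.

Lemma inner_standard (f : V -> C) u : inner f (kerdock_vector None u) = f u.
Proof.
rewrite /inner (bigD1 u) //= eqxx rmorph1 mulr1 big1 ?addr0 // => x /negPf->.
by rewrite rmorph0 mulr0.
Qed.

Lemma inner_quad (f : V -> C) i u :
  inner f (kerdock_vector (Some i) u) =
    \sum_x f x * (-1) ^+ (Q i x (+) << u, x >>).
Proof. by apply: eq_bigr => x _; rewrite rmorph_sign. Qed.

Lemma inner_quad_same i u w :
  inner (kerdock_vector (Some i) u) (kerdock_vector (Some i) w) =
    (#|V| * (u == w))%:R.
Proof.
rewrite inner_quad -(addv_eq0 K) -(sum_sign_dot _ K); apply: eq_bigr => x _.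
rewrite -signr_addb dotDr (dotC K u) (dotC K w).
by case: (Q i x); case: << x, u >>; case: << x, w >>.
Qed.

Lemma inner_kerdock o u :
  inner (kerdock_vector o u) (kerdock_vector o u) =
    if o is Some _ then #|V|%:R else 1.
Proof.
case: o => [i|]; first by rewrite inner_quad_same eqxx muln1.
by rewrite inner_standard /= eqxx.
Qed.

(** For [strongly_unextendible]: being unbiased to the standard basis excludes a
    zero entry, whereas the other bases force one by [flat_vanishes]. *)
Lemma kerdock_MUBs : #|V| = (2 * #|I|)%N -> (2 < #|V|)%N ->
  exists E : 'I_#|I|.+1 -> #|V|.-tuple 'rV[C]_#|V|,
    MUBs E /\ strongly_unextendible E.
Proof.
move=> cardVI Vgt2; have V0 : #|V|%:R != 0 :> C.
  by rewrite pnatr_eq0 -lt0n (leq_trans _ Vgt2).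
apply: (unextendible_MUBs_of_functions (erefl #|V|) (e := kerdock_vector)).
- exact: card_option.
- exact: leq_trans Vgt2.
- by move=> o u; rewrite inner_kerdock; case: o => [_|] //; apply: oner_neq0.
- move=> [i|] u w uw; first by rewrite inner_quad_same (negPf uw) muln0.
  by rewrite inner_standard /= eq_sym (negPf uw).
- move=> [i|] [j|] u w // ij; rewrite !inner_kerdock.
  + rewrite inner_quad real_normK; first by rewrite (sum_sign_quad C K u w ij).
    by apply: rpred_sum => x _; apply: rpredM; apply: rpred_sign.
  + by rewrite inner_standard /= normr_sign expr1n mul1r mulr1.
  + rewrite inner_quad (bigD1 u) //= eqxx big1 ?addr0 => [|x /negPf->].
      by rewrite !mul1r normr_sign expr1n mul1r.
    by rewrite mul0r.
move=> f unb.
have flat i u : `|\sum_x f x * (-1) ^+ (Q i x (+) << u, x >>)| ^+ 2 = inner f f.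
  by apply: (mulIf V0); rewrite -inner_quad unb inner_kerdock.
have [x fx] := flat_vanishes flat cardVI Vgt2.
have := unb None x; rewrite inner_standard inner_kerdock mulr1 fx normr0.
by rewrite expr0n mul0r.
Qed.

End KerdockBases.

Theorem theorem7 (R : realType) (h : nat) (hh : (1 <= h)%N) :
  exists E : 'I_(2 ^ (2 * h - 1) + 1) ->
             (2 ^ (2 * h)).-tuple 'rV[R[i]]_(2 ^ (2 * h)),
    MUBs E /\ strongly_unextendible E.
Proof.
set m := (2 * h - 1)%N.
have m_gt0 : (0 < m)%N by rewrite subn_gt0; case: h hh @m => // h' _ _; rewrite mulnS.
have mS : (2 * h)%N = m.+1 by rewrite /m subn1 prednK // muln_gt0.
have m_odd : odd m by have := oddM 2 h; rewrite mS => /negbFE.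
have [F pchar2 cardF] := pPrimePowerField (isT : prime 2) m_gt0.
have := kerdock_MUBs R (field_kerdock_set pchar2 cardF m_odd).
rewrite card_prod card_bool cardF mS addn1 mulnC -expnS.
by apply=> //; rewrite (ltn_exp2l 1).
Qed.
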